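(* There exists an $O(n^2)$-time algorithm that, given an $n$-vertex $1$-plane graph $G$, tests whether $G$ admits an edge partition in which the red graph has maximum vertex degree at most one, and, if so, computes such an edge partition.
   Context: A $1$-plane graph is a graph with a given embedding in the plane (an equivalence class of simple drawings with the same planarization, where a simple drawing has edges as Jordan arcs meeting pairwise in at most one point, either a common endpoint or a proper crossing) in which every edge is crossed at most once. An edge partition of a $1$-plane graph $G$ is a coloring of each edge red or blue such that the subgraph induced by the red edges and the subgraph induced by the blue edges are both plane in the given embedding (no two edges of the same color cross). *)

(* Defs.v *)
From HB Require Import structures.
From mathcomp Require Import all_boot all_order all_algebra.
From mathcomp Require Import all_classical all_reals all_analysis.
Import Order.TTheory GRing.Theory Num.Theory.
Import numFieldNormedType.Exports.

Set Implicit Arguments.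
Unset Strict Implicit.
Unset Printing Implicit Defensive.

Local Open Scope ring_scope.

(** * Curves in the plane *)

Section Curves.
Variable R : realType.
Implicit Types (p q r : R * R) (a b c : R -> R * R).

Definition sqdist p q : R := (p.1 - q.1) ^+ 2 + (p.2 - q.2) ^+ 2.

(* Positive iff p, q, r are in counterclockwise order on their circumcircle. *)
Definition orient p q r : R :=
  (q.1 - p.1) * (r.2 - p.2) - (q.2 - p.2) * (r.1 - p.1).

Definition jordan_arc a : Prop :=
  {within `[0, 1], continuous a}%classic /\
  {in `[0, 1] &, injective a}.

Definition subarc a (x y : R) : R -> R * R := fun t => a (x + t * (y - x)).

(* [t] is the first time at which [a] reaches the circle of radius [rho]
   centred at its starting point. *)
Definition first_exit a (rho t : R) : Prop :=
  [/\ t \in `[0, 1],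
      sqdist (a t) (a 0) = rho ^+ 2
    & forall u : R, 0 <= u < t -> sqdist (a u) (a 0) < rho ^+ 2].

(* Three arcs that start at the same point and are otherwise disjoint leave it
   in counterclockwise order: so do their first exits from every small disc
   around that point. *)
Definition ccw a b c : Prop :=
  exists2 rho0 : R, 0 < rho0 &
    forall rho : R, 0 < rho < rho0 ->
      exists t u v : R, [/\ first_exit a rho t, first_exit b rho u,
                        first_exit c rho v & 0 < orient (a t) (b u) (c v)].

(* The arcs [a] and [b] cross properly at [a s = b t], with [b] passing from the
   right of [a] to its left: the four branches at that point are, in
   counterclockwise order, a forward, b forward, a backward, b backward. *)
Definition crosses_leftward_at a b (s t : R) : Prop :=
  [/\ s \in `]0, 1[, t \in `]0, 1[, a s = b t,
      ccw (subarc a s 1) (subarc b t 1) (subarc a s 0)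
    & ccw (subarc a s 0) (subarc b t 0) (subarc a s 1)].

Definition crosses_properly_at a b (s t : R) : Prop :=
  crosses_leftward_at a b s t \/ crosses_leftward_at b a t s.

End Curves.

(** * Graphs and their drawings *)

(* Each edge carries an arbitrary reference direction. Loops and parallel edges
   are ruled out by the existence of a simple drawing. *)
Record graph := Graph {
  nv : nat;
  ne : nat;
  src : 'I_ne -> 'I_nv;
  tgt : 'I_ne -> 'I_nv }.

Definition half_edge (G : graph) : Type := ('I_(ne G) * bool)%type.

Definition origin (G : graph) (h : half_edge G) : 'I_(nv G) :=
  if h.2 then tgt h.1 else src h.1.

Record drawing (R : realType) (G : graph) := Drawing {
  pos : 'I_(nv G) -> R * R;
  curve : 'I_(ne G) -> R -> R * R }.

Section Drawings.
Variables (R : realType) (G : graph) (D : drawing R G).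
Implicit Types (e f g : 'I_(ne G)) (h k : half_edge G).

Definition simple_drawing : Prop :=
  [/\ injective (pos D),
      forall e, [/\ jordan_arc (curve D e), curve D e 0 = pos D (src e)
                  & curve D e 1 = pos D (tgt e)],
      forall e v (t : R), t \in `[0, 1] -> curve D e t = pos D v ->
        t = 0 \/ t = 1,
      forall e f, e != f -> forall s t s' t' : R,
        [/\ s \in `[0, 1], t \in `[0, 1], s' \in `[0, 1] & t' \in `[0, 1]] ->
        curve D e s = curve D f t -> curve D e s' = curve D f t' ->
        s = s' /\ t = t'
    & forall e f, e != f -> forall s t : R, s \in `[0, 1] -> t \in `[0, 1] ->
        curve D e s = curve D f t ->
        (s = 0 \/ s = 1) /\ (t = 0 \/ t = 1) \/
        crosses_properly_at (curve D e) (curve D f) s t].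

Definition crosses_leftward e f : Prop :=
  e != f /\ exists s t : R, crosses_leftward_at (curve D e) (curve D f) s t.

Definition crosses e f : Prop := crosses_leftward e f \/ crosses_leftward f e.

Definition crossed_at_most_once : Prop :=
  forall e f g, crosses e f -> crosses e g -> f = g.

Definition half_arc h : R -> R * R :=
  if h.2 then subarc (curve D h.1) 1 0 else subarc (curve D h.1) 0 1.

(* [k] follows [h] in the counterclockwise order around their common origin;
   [h] follows itself iff its origin has degree one. *)
Definition next_ccw h k : Prop :=
  [/\ origin k = origin h,
      k = h -> forall l, origin l = origin h -> l = h
    & forall l, origin l = origin h -> l != h -> l != k ->
        ccw (half_arc h) (half_arc k) (half_arc l)].

End Drawings.

(** * 1-plane graphs *)

(* The planarization of a drawing of [G] in which every edge is crossed at most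
   once. [partner e] is [None] if e is uncrossed, and [Some (f, b)] if e is
   crossed by f, from right to left exactly when b is true; b thus fixes the
   cyclic order of the four edge segments at the dummy vertex replacing the
   crossing. [succ_ccw] gives the cyclic order of the edges at the vertices of
   [G]. *)
Record planarization (G : graph) := Planarization {
  partner : 'I_(ne G) -> option ('I_(ne G) * bool);
  succ_ccw : half_edge G -> half_edge G }.

Definition planarization_of (R : realType) (G : graph) (D : drawing R G)
    (P : planarization G) : Prop :=
  [/\ forall e f, partner P e = Some (f, true) <-> crosses_leftward D e f,
      forall e f, partner P e = Some (f, false) <-> crosses_leftward D f e
    & forall h, next_ccw D h (succ_ccw P h)].

(* A graph with an embedding, i.e. with the class of all its simple drawings
   that have a given planarization. *)
Record one_plane_graph (R : realType) := OnePlaneGraph {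
  opg_graph :> graph;
  opg_plan : planarization opg_graph;
  opg_drawable : exists D : drawing R opg_graph,
    [/\ simple_drawing D, crossed_at_most_once D
      & planarization_of D opg_plan] }.

(** * Edge partitions *)

Section EdgePartition.
Variables (R : realType) (G : one_plane_graph R).
Implicit Types (A : {set 'I_(ne G)}) (v : 'I_(nv G)).

Definition cross_in_embedding (e f : 'I_(ne G)) : bool :=
  if partner (opg_plan G) e is Some (g, _) then g == f else false.

Definition plane_subgraph A : Prop :=
  {in A &, forall e f, ~~ cross_in_embedding e f}.

(* The blue edges are those that are not red. *)
Definition edge_partition (red : {set 'I_(ne G)}) : Prop :=
  plane_subgraph red /\ plane_subgraph (~: red).

Definition degree A v : nat :=
  #|[set e in A | (src e == v) || (tgt e == v)]|.

Definition max_degree A : nat := (\max_(v < nv G) degree A v)%N.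

End EdgePartition.

(** * A word RAM *)

Local Open Scope nat_scope.

(* Registers and memory cells are numbered by nat; arguments are registers. *)
Inductive instr :=
| IConst (r k : nat)      (* r := k *)
| IMove (r a : nat)       (* r := a *)
| IAdd (r a b : nat)      (* r := a + b *)
| ISub (r a b : nat)      (* r := a - b, truncated at 0 *)
| IMul (r a b : nat)      (* r := a * b *)
| IRead (r a : nat)       (* r := memory[a] *)
| IWrite (a b : nat).     (* memory[a] := b *)

Inductive program :=
| PSkip
| PDo (i : instr)
| PSeq (p q : program)
| PIf (r : nat) (p q : program)   (* p if r is nonzero, otherwise q *)
| PWhile (r : nat) (p : program). (* repeat p as long as r is nonzero *)

Record state := State { reg : nat -> nat; memory : nat -> nat }.

Definition upd (m : nat -> nat) (i x : nat) : nat -> nat :=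
  fun j => if j == i then x else m j.

Definition set_reg (s : state) (r x : nat) : state :=
  State (upd (reg s) r x) (memory s).

Definition exec_instr (i : instr) (s : state) : state :=
  match i with
  | IConst r k => set_reg s r k
  | IMove r a => set_reg s r (reg s a)
  | IAdd r a b => set_reg s r (reg s a + reg s b)
  | ISub r a b => set_reg s r (reg s a - reg s b)
  | IMul r a b => set_reg s r (reg s a * reg s b)
  | IRead r a => set_reg s r (memory s (reg s a))
  | IWrite a b => State (reg s) (upd (memory s) (reg s a) (reg s b))
  end.

Definition fits (W : nat) (s : state) : Prop :=
  (forall r, reg s r < W) /\ (forall a, memory s a < W).

(* [exec W p s T s']: from [s], the program [p] halts in [s'] after [T] steps of
   unit cost. A machine word holds the numbers less than [W]; a computation that
   produces a larger number is stuck. *)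
Inductive exec (W : nat) : program -> state -> nat -> state -> Prop :=
| ExecSkip s :
    exec W PSkip s 1 s
| ExecDo i s :
    fits W (exec_instr i s) -> exec W (PDo i) s 1 (exec_instr i s)
| ExecSeq p q s T s' T' s'' :
    exec W p s T s' -> exec W q s' T' s'' -> exec W (PSeq p q) s (T + T') s''
| ExecIfTrue r p q s T s' :
    reg s r != 0 -> exec W p s T s' -> exec W (PIf r p q) s T.+1 s'
| ExecIfFalse r p q s T s' :
    reg s r = 0 -> exec W q s T s' -> exec W (PIf r p q) s T.+1 s'
| ExecWhileStop r p s :
    reg s r = 0 -> exec W (PWhile r p) s 1 s
| ExecWhileLoop r p s T s' T' s'' :
    reg s r != 0 -> exec W p s T s' -> exec W (PWhile r p) s' T' s'' ->
    exec W (PWhile r p) s (T + T').+1 s''.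

(** * Input and output *)

Definition encode_half_edge (G : graph) (h : half_edge G) : nat :=
  2 * h.1 + h.2.

Definition encode_edge (G : graph) (P : planarization G) (e : 'I_(ne G)) :
    seq nat :=
  [:: nat_of_ord (src e); nat_of_ord (tgt e);
      if partner P e is Some (f, _) then f.+1 else 0;
      if partner P e is Some (_, b) then nat_of_bool b else 0;
      encode_half_edge (succ_ccw P (e, false));
      encode_half_edge (succ_ccw P (e, true))].

Definition encode (R : realType) (G : one_plane_graph R) : seq nat :=
  [:: nv G; ne G] ++
  flatten [seq encode_edge (opg_plan G) e | e <- enum 'I_(ne G)].

Definition initial_state (input : seq nat) : state :=
  State (fun _ => 0) (nth 0 input).

Definition accepts (s : state) : Prop := reg s 0 = 1.

Definition rejects (s : state) : Prop := reg s 0 = 0.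

Definition output_edges (m : nat) (s : state) : {set 'I_m} :=
  [set e : 'I_m | memory s e == 1].

(* Main.v *)
Require Import Defs.
From mathcomp Require Import all_boot all_order all_algebra.
From mathcomp Require Import all_classical all_reals all_analysis.
From mathcomp Require Import zify.
Import Order.TTheory GRing.Theory Num.Theory.

Local Open Scope nat_scope.

(* Uncrossed edges may be blue, so the question is whether one edge can be chosen
   from each crossing pair such that the chosen edges form a matching. The pairs
   are inserted one at a time, as in cuckoo hashing: choosing an edge evicts the
   edges chosen before at its two ends, whose partners must then be chosen in
   turn. A clash between two edges forced by the choice of [e] shows that no
   solution contains [e]; otherwise the forced edges override the old choices. If
   neither edge of a pair can be inserted, there is no solution. An insertion
   occupies each vertex at most once, so it takes O(n) steps; since the chosen
   edges form a matching, at most n insertions succeed and the algorithm stops at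
   the first failure. The absence of loops and parallel edges bounds the number of
   edges by n^2, which is enough for scanning them; planarity is not needed. *)

(** * Inserting crossing pairs *)

Section Propagation.

Variables (n m : nat) (sr tg pa : nat -> nat).

(** Number 0 is left free to mean no edge: as the partner of an uncrossed edge and as the entry of a
    vacant vertex. *)
Definition edge x := 0 < x <= m.

Hypothesis sr_lt : forall x, edge x -> sr x < n.
Hypothesis tg_lt : forall x, edge x -> tg x < n.
Hypothesis sr_tg : forall x, edge x -> sr x != tg x.
Hypothesis pa_edge : forall x, edge x -> pa x != 0 -> edge (pa x).
Hypothesis paK : forall x, edge x -> pa x != 0 -> pa (pa x) = x.
Hypothesis pa_neq : forall x, edge x -> pa x != x.

Definition incident x v := (sr x == v) || (tg x == v).

Definition solution (S : pred nat) :=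
  (forall x, edge x -> pa x != 0 -> S (pa x) = ~~ S x) /\
  (forall x y v, edge x -> edge y -> S x -> S y ->
     incident x v -> incident y v -> x = y).

(* [f v] is the chosen edge at [v], and 0 if there is none. *)
Definition occupancy (f : nat -> nat) :=
  forall v, v < n -> f v != 0 ->
    [/\ edge (f v), incident (f v) v, f (sr (f v)) = f v & f (tg (f v)) = f v].

(** Testing the source suffices, because an occupancy has the same entry at both ends of an edge. *)
Definition selected (f : nat -> nat) x := f (sr x) == x.

Lemma selected_incident {f x v} :
  occupancy f -> edge x -> selected f x -> incident x v -> f v = x.
Proof.
move=> occ ex /eqP fx; have x0 : x != 0 by move: ex; rewrite /edge; lia.
have := occ _ (sr_lt _ ex); rewrite fx => /(_ x0) [_ _ fs ft].
by case/orP => /eqP <-.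
Qed.

Lemma occupancy_selected {f v} :
  occupancy f -> v < n -> f v != 0 -> selected f (f v).
Proof. by move=> occ vn /(occ _ vn)[_ _ fv _]; exact/eqP. Qed.

Lemma occupancy_le {f v} : occupancy f -> v < n -> f v <= m.
Proof.
move=> occ vn; have [->//|fv] := eqVneq (f v) 0.
by have [/andP[]] := occ _ vn fv.
Qed.

Lemma incident_lt {x v} : edge x -> incident x v -> v < n.
Proof.
by move=> ex /orP[] /eqP <-; [exact: sr_lt | exact: tg_lt].
Qed.

Definition occupy f x := upd (upd f (sr x) x) (tg x) x.

Lemma occupyE f x v : occupy f x v = if incident x v then x else f v.
Proof.
by rewrite /occupy /upd /incident ![v == _]eq_sym; case: (sr x == v); case: (tg x == v).
Qed.

Lemma occupancy_occupy f x : occupancy f -> edge x ->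
  f (sr x) = 0 -> f (tg x) = 0 -> occupancy (occupy f x).
Proof.
move=> occ ex fs ft v vn; rewrite !(occupyE f x v).
case: ifPn => [xv _|nxv fv].
  by split=> //; rewrite occupyE /incident eqxx ?orbT.
have [efv fvv fsv ftv] := occ _ vn fv.
(* An edge of [f] sharing an end with [x] would be recorded at that end, where [f] is 0. *)
split=> //; rewrite occupyE; case: ifPn => // /orP[] /eqP E.
- by rewrite -E fs in fsv; rewrite -fsv in fv.
- by rewrite -E ft in fsv; rewrite -fsv in fv.
- by rewrite -E fs in ftv; rewrite -ftv in fv.
- by rewrite -E ft in ftv; rewrite -ftv in fv.
Qed.

Lemma selected_occupy f x y : edge y -> f (sr x) = 0 -> f (tg x) = 0 ->
  selected (occupy f x) y = (y == x) || selected f y.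
Proof.
move=> ey fs ft; rewrite ![selected _ _]/selected occupyE; case: ifPn => [xy|nxy].
  have -> : f (sr y) = 0 by case/orP: xy => /eqP <-.
  by rewrite eq_sym; case: (y =P x) => //= _; move: ey; rewrite /edge; lia.
case: (y =P x) nxy => [->|//]; by rewrite /incident eqxx.
Qed.

(** Added to the stack size, this is the potential that bounds the cost of an insertion: occupying
    an edge takes it off the stack, fills two vacancies and pushes at most two edges. *)
Definition vacancies (f : nat -> nat) := count (fun v => f v == 0) (iota 0 n).

Lemma vacancies_upd f v x : v < n -> f v = 0 -> x != 0 -> (vacancies (upd f v x)).+1 = vacancies f.
Proof.
move=> vn fv x0; rewrite /vacancies.
have vi : v \in iota 0 n by rewrite mem_iota.
have fx : upd f v x v = x by rewrite /upd eqxx.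
rewrite -!sum1_count !(big_rem v vi) /= fv fx (negPf x0) /= add0n add1n.
congr _.+1; rewrite big_seq_cond [RHS]big_seq_cond; apply: eq_bigl => w.
case: (boolP (w \in rem v _)) => //=; rewrite mem_rem_uniq ?iota_uniq // inE.
by rewrite /upd; case: eqP.
Qed.

(** There are no loops, so two distinct cells are filled. *)
Lemma vacancies_occupy f x : edge x -> f (sr x) = 0 -> f (tg x) = 0 ->
  (vacancies (occupy f x)).+2 = vacancies f.
Proof.
move=> ex fs ft; have x0 : x != 0 by move: ex; rewrite /edge; lia.
rewrite vacancies_upd ?vacancies_upd //; [exact: sr_lt|exact: tg_lt|].
by rewrite /upd eq_sym (negPf (sr_tg _ ex)).
Qed.

Lemma vacancies_le f : vacancies f <= n.
Proof. by rewrite /vacancies (leq_trans (count_size _ _)) ?size_iota. Qed.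

(* The crossing pairs whose smaller edge is less than [j] have been inserted into
   [old]. *)
Definition settled j old :=
  [/\ occupancy old,
      forall x, edge x -> selected old x -> pa x != 0 /\ minn x (pa x) < j
    & forall x, edge x -> pa x != 0 -> minn x (pa x) < j ->
        selected old (pa x) = ~~ selected old x].

Lemma settled_init : settled 1 (fun=> 0).
Proof.
split=> // x ex; first by rewrite /selected => /eqP x0; move: ex; rewrite /edge -x0.
by move=> x0 /=; move: ex; rewrite /edge; lia.
Qed.

(** Either [j] is uncrossed, or its partner is smaller and the pair has been inserted already. *)
Lemma settledS j old : edge j -> ~~ (j < pa j) -> settled j old -> settled j.+1 old.
Proof.
move=> ej npj [occ sel alt]; split=> // x ex.
  by case/(sel _ ex) => x0 xj; split=> //; lia.
move=> px0 xj; apply: alt => //; have := pa_neq _ ej; have := pa_neq _ ex.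
have := paK _ ex px0; have [->|] := eqVneq x j; first by lia.
have [E|] := eqVneq (pa x) j; last by lia.
by rewrite E => _; lia.
Qed.

Lemma settled_solution old : settled m.+1 old -> solution (fun x => edge x && selected old x).
Proof.
case=> occ sel alt; split=> [x ex px0|x y v ex ey /andP[_ sx] /andP[_ sy] xv yv].
  by rewrite pa_edge // ex alt //=; move: ex; rewrite /edge; lia.
by rewrite -(selected_incident occ ex sx xv) (selected_incident occ ey sy yv).
Qed.

Definition pairs j := count (fun x => x < pa x) (iota 1 j.-1).

Lemma pairsS j : 0 < j -> pairs j.+1 = pairs j + (j < pa j).
Proof.
case: j => // j _; have E : iota 1 j.+1 = iota 1 j ++ [:: j.+1].
  by rewrite -{1}(addn1 j) iotaD add1n.
by rewrite /pairs !succnK E count_cat /= addn0.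
Qed.

(** The edges chosen from the pairs form a matching, so their sources are distinct vertices. *)
Lemma pairs_le j old : settled j old -> j <= m.+1 -> pairs j <= n.
Proof.
case=> occ sel alt jm.
pose g x := sr (if selected old x then x else pa x).
rewrite /pairs -size_filter -(size_map g) -[n in _ <= n](size_iota 0).
have E x : x \in [seq x <- iota 1 j.-1 | x < pa x] ->
    [/\ edge x, x < pa x & x < j].
  by rewrite mem_filter mem_iota /edge => /andP[-> ?]; split=> //; lia.
have S x : x \in [seq x <- iota 1 j.-1 | x < pa x] ->
    old (g x) = if selected old x then x else pa x.
  move=> /E[ex px xj]; rewrite /g; case: ifPn => [/eqP //|nx].
  have px0: pa x != 0 by lia.
  by apply/eqP; rewrite -/(selected old (pa x)) alt //; lia.
apply: uniq_leq_size.
  rewrite map_inj_in_uniq ?filter_uniq ?iota_uniq // => x y xs ys gxy.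
  have [[ex px _] [ey py _]] := (E _ xs, E _ ys).
  have := S _ xs; rewrite gxy (S _ ys) => yx.
  have pKx : pa (pa x) = x by apply: paK => //; lia.
  have pKy : pa (pa y) = y by apply: paK => //; lia.
  (* The chosen edges agree, hence so do their pairs, of which [x] and [y] are both the smaller
     edge. *)
  by move: yx; case: ifP => _; case: ifP => _ e; have := congr1 pa e; lia.
move=> _ /mapP[x /E[ex px xj] ->]; rewrite mem_iota /= /g.
by case: ifP => _; apply: sr_lt => //; apply: pa_edge => //; lia.
Qed.

(** * Consequences of choosing one edge *)

Section Forcing.

Variables (j e0 : nat) (old : nat -> nat).
Hypothesis old_settled : settled j old.
Hypotheses (e0_edge : edge e0) (e0_pa : pa e0 != 0) (e0_min : minn e0 (pa e0) = j).

(** A forced edge other than [e0] replaces its partner, chosen in [old]. Hence no forced edge is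
    itself chosen in [old]. *)
Definition forceable x := [/\ edge x, pa x != 0 & x = e0 \/ selected old (pa x)].

(* Choosing [e0] forces the edges in [new], whose consequences have been drawn,
   and those in [stk], whose consequences have not. *)
Definition forcing new (stk : seq nat) :=
  [/\ occupancy new,
      forall x, edge x -> selected new x \/ x \in stk ->
        forceable x /\ (forall S, solution S -> S e0 -> S x),
      forall x, x \in stk -> edge x,
      forall v, v < n -> new v != 0 -> old v != 0 ->
        pa (old v) \in stk \/ selected new (pa (old v))
    & e0 \in stk \/ selected new e0].

Lemma forcing_init new : (forall v, v < n -> new v = 0) -> forcing new [:: e0].
Proof.
move=> new0; split.
- by move=> v /new0 ->.
- move=> x ex [/eqP sx|].
    by move: (new0 _ (sr_lt _ ex)) (ex); rewrite sx /edge => ->.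
  by rewrite inE => /eqP ->; split=> //; split=> //; left.
- by move=> x; rewrite inE => /eqP ->.
- by move=> v /new0 ->.
- by left; rewrite inE.
Qed.

Lemma forcing_pop new stk x :
  selected new x -> forcing new (rcons stk x) -> forcing new stk.
Proof.
move=> sx [occ frc stke cls e0s]; split=> //.
- by move=> y ey [sy|ys]; apply: frc => //; [left|right; rewrite mem_rcons inE ys orbT].
- by move=> y ys; apply: stke; rewrite mem_rcons inE ys orbT.
- move=> v vn nv ov; case: (cls v vn nv ov) => [|?]; last by right.
  by rewrite mem_rcons inE => /orP[/eqP ->|]; [right|left].
- case: e0s => [|]; last by right.
  by rewrite mem_rcons inE => /orP[/eqP ->|]; [right|left].
Qed.

(** A solution containing [e0] contains [x] and also the forced edge at an occupied end of [x];
    these would have to coincide, although [x] is not in [new]. *)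
Lemma forcing_conflict new stk x : forcing new (rcons stk x) ->
  ~~ selected new x -> new (sr x) + new (tg x) != 0 ->
  forall S, solution S -> ~~ S e0.
Proof.
move=> [occ frc stke _ _] nsx; have xs : x \in rcons stk x by rewrite mem_rcons inE eqxx.
have ex := stke _ xs.
rewrite addn_eq0 negb_and => nst.
have [v xv nv] : exists2 v, incident x v & new v != 0.
  by case/orP: nst; [exists (sr x)|exists (tg x)] => //; rewrite /incident eqxx ?orbT.
move=> S Ssol; apply/negP => Se0.
have vn := incident_lt ex xv.
have [env nvv _ _] := occ _ vn nv.
have Sx : S x by have [_ ->] := frc _ ex (or_intror xs).
have Sn : S (new v).
  by have [_ ->] := frc _ env (or_introl (occupancy_selected occ vn nv)).
have E := proj2 Ssol _ _ _ ex env Sx Sn xv nvv.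
by move: nsx; rewrite E occupancy_selected.
Qed.

(** Choosing an edge at [v] evicts [old v], whose partner must then be chosen. *)
Definition pushed v := if old v == 0 then [::] else [:: pa (old v)].

(** A solution containing [e0] contains [x], hence not the old edges at the ends of [x], hence their
    partners. These are the pushed edges. *)
Lemma forcing_occupy new stk x : forcing new (rcons stk x) ->
  new (sr x) = 0 -> new (tg x) = 0 ->
  forcing (occupy new x) ((stk ++ pushed (sr x)) ++ pushed (tg x)).
Proof.
have [oocc osel oalt] := old_settled.
move=> [occ frc stke cls e0s] ns nt; have xs : x \in rcons stk x by rewrite mem_rcons inE eqxx.
have ex := stke _ xs.
have [[_ px0 xe0] Sx] := frc _ ex (or_intror xs).
have nx : ~~ selected old x.
  apply/negP => sx; case: xe0 => [xE|spx].
    by have [_] := osel _ ex sx; rewrite xE e0_min ltnn.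
  have [_ xj] := osel _ ex sx; by rewrite oalt ?sx in spx.
have pushedP y v : incident x v -> y \in pushed v ->
    [/\ edge y, forceable y & forall S, solution S -> S e0 -> S y].
  move=> xv; rewrite /pushed; case: ifPn => // ov; rewrite inE => /eqP ->.
  have vn := incident_lt ex xv.
  have [eo ov' _ _] := oocc _ vn ov; have so := occupancy_selected oocc vn ov.
  have [po _] := osel _ eo so; split; first exact: pa_edge.
    split; [exact: pa_edge| |by right; rewrite paK].
    by rewrite paK.
  move=> S Ssol Se0; rewrite (proj1 Ssol) //; apply/negP => So.
  have E := proj2 Ssol _ _ _ ex eo (Sx _ Ssol Se0) So xv ov'.
  by move: nx; rewrite E so.
have srx : incident x (sr x) by rewrite /incident eqxx.
have tgx : incident x (tg x) by rewrite /incident eqxx orbT.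
have selO y : edge y -> selected (occupy new x) y = (y == x) || selected new y.
  by move=> ey; apply: selected_occupy.
split.
- exact: occupancy_occupy.
- move=> y ey; rewrite selO // !mem_cat => -[/orP[/eqP ->|sy]|].
  + by split.
  + by apply: frc => //; left.
  + case/orP => [/orP[ys|]|].
    * by apply: frc => //; right; rewrite mem_rcons inE ys orbT.
    * by move=> /(pushedP _ _ srx)[].
    * by move=> /(pushedP _ _ tgx)[].
- move=> y; rewrite !mem_cat => /orP[/orP[ys|]|].
  + by apply: stke; rewrite mem_rcons inE ys orbT.
  + by move=> /(pushedP _ _ srx)[].
  + by move=> /(pushedP _ _ tgx)[].
- move=> v vn; rewrite occupyE; case: ifPn => [xv _ ov|nxv nv ov].
    have ovP : pa (old v) \in pushed v by rewrite /pushed (negPf ov) inE.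
    by left; rewrite !mem_cat; case/orP: xv => /eqP ->; rewrite ovP ?orbT.
  have [eo _ _ _] := oocc _ vn ov.
  have [po _] := osel _ eo (occupancy_selected oocc vn ov).
  have epo := pa_edge _ eo po.
  rewrite selO //; case: (cls v vn nv ov) => [|->]; last by right; rewrite orbT.
  rewrite mem_rcons inE => /orP[->|]; first by right.
  by move=> ys; left; rewrite !mem_cat ys.
- rewrite selO //; case: e0s => [|->]; last by right; rewrite orbT.
  rewrite mem_rcons inE => /orP[->|]; first by right.
  by move=> ys; left; rewrite !mem_cat ys.
Qed.

(** An evicted edge may have an end that no forced edge occupies; the second case clears it
    there. *)
Definition commit (new : nat -> nat) (v : nat) : nat :=
  if new v != 0 then new v
  else if (old v != 0) && selected new (pa (old v)) then 0 else old v.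

(** With an empty stack every eviction has been followed up: an old edge either keeps both its ends
    or has been replaced by its partner. *)
Lemma settled_commit new : forcing new [::] ->
  forall f, (forall v, v < n -> f v = commit new v) -> settled j.+1 f.
Proof.
have [oocc osel oalt] := old_settled.
move=> [nocc frc _ cls e0s] f fE.
have {e0s} se0 : selected new e0 by case: e0s.
have {}frc x : edge x -> selected new x -> forceable x.
  by move=> ex sx; have [] := frc _ ex (or_introl sx).
have {}cls v : v < n -> new v != 0 -> old v != 0 -> selected new (pa (old v)).
  by move=> vn nv ov; case: (cls v vn nv ov).
have minpa x : edge x -> pa x != 0 -> minn (pa x) (pa (pa x)) = minn x (pa x).
  by move=> ex px; rewrite paK // minnC.
have selF x : edge x ->
    selected f x = selected new x || selected old x && ~~ selected new (pa x).
  move=> ex; have x0 : x != 0 by move: ex; rewrite /edge; lia.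
  have sn := sr_lt _ ex; have xN : (0 == x) = false by rewrite eq_sym (negPf x0).
  rewrite [selected f x]/selected fE // /commit; case: ifPn => nx.
    rewrite -/(selected new x); case: (boolP (selected new x)) => //= nsx.
    (* A forced edge occupies the source of [x], so if [x] were old, its partner would be forced. *)
    apply/esym/negbTE/negP => /andP[/eqP sx]; by rewrite -{1}sx cls // sx.
  have -> : selected new x = false by rewrite /selected; move/negPn/eqP: nx => ->.
  case: (boolP (selected old x)) => [/eqP sx|nsx] /=.
    by rewrite sx x0 /=; case: ifP => _ //=; rewrite eqxx.
  by case: ifP => _; [exact: xN | exact: negPf nsx].
(* If both edges of a pair were forced, each would be [e0] or have the other in [old]; but [old]
   contains neither edge of the pair of [e0] and at most one of any other pair. *)
have nboth x : edge x -> selected new x -> ~~ selected new (pa x).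
  move=> ex sx; apply/negP => spx.
  have [_ px0 xE] := frc _ ex sx; have epx := pa_edge _ ex px0.
  have [_ _] := frc _ epx spx; rewrite paK //.
  case: xE => [xE|opx].
    case=> [E|]; first by have := pa_neq _ ex; rewrite E -xE eqxx.
    by move=> /(osel _ ex)[_]; rewrite xE e0_min ltnn.
  case=> [E|ox].
    by have [_] := osel _ epx opx; rewrite E e0_min ltnn.
  have [_ xj] := osel _ ex ox.
  by move: opx; rewrite oalt ?ox.
split.
- move=> v vn; rewrite {1}fE // /commit.
  (* A forced edge holds its ends in [new]; a surviving old edge holds them because a forced edge at
     either end would have forced its partner. *)
  have keep y : edge y -> selected f y -> forall w, incident y w -> f w = y.
    move=> ey; rewrite selF // => sy w yw; have wn := incident_lt ey yw.
    have y0 : y != 0 by move: ey; rewrite /edge; lia.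
    rewrite fE // /commit; case/orP: sy => [sy|/andP[oy ny]].
      by rewrite (selected_incident nocc ey sy yw) y0.
    have oE := selected_incident oocc ey oy yw.
    rewrite oE y0 (negPf ny) /=; case: ifPn => // nw.
    by move: ny; rewrite -{1}oE cls // oE.
  suff: f v != 0 -> edge (f v) /\ incident (f v) v /\ selected f (f v).
    move=> H; rewrite -/(commit new v) -fE // => /H [ev [iv sv]].
    split=> //; apply: keep => //; by rewrite /incident eqxx ?orbT.
  rewrite {1}fE // /commit; case: ifPn => [nv _|].
    have [ev iv _ _] := nocc _ vn nv; rewrite fE // /commit nv.
    by split=> //; split=> //; rewrite selF // occupancy_selected.
  move=> nv; case: ifPn => // nov ov.
  have [ev iv _ _] := oocc _ vn ov; rewrite fE // /commit (negPf nv) (negPf nov).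
  split=> //; split=> //; rewrite selF // occupancy_selected //=.
  by move: nov; rewrite ov /= => ->; rewrite orbT.
- move=> x ex; rewrite selF // => /orP[sx|/andP[sx _]].
    have [_ px xE] := frc _ ex sx; split=> //; case: xE => [->|]; first by rewrite e0_min.
    by move=> /(osel _ (pa_edge _ ex px))[_]; rewrite minpa // => /ltnW.
  by have [? ?] := osel _ ex sx; split=> //; lia.
- move=> x ex px xj; have epx := pa_edge _ ex px.
  rewrite !selF // paK //.
  case: (boolP (selected new x)) => [sx|nsx] /=.
    by rewrite (negPf (nboth _ ex sx)) andbF.
  case: (boolP (selected new (pa x))) => [//|nspx] /=; first by rewrite andbF.
  rewrite !andbT; apply: oalt => //.
  (* Neither edge of this pair is forced, so it is not the pair of [e0]; its smaller edge therefore
     differs from [j] and precedes it, and [old] has settled the pair. *)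
  have [xe|] := eqVneq x e0; first by move: nsx; rewrite xe se0.
  have [xe|] := eqVneq (pa x) e0; first by move: nspx; rewrite xe se0.
  move=> pxe xe; rewrite ltn_neqAle -ltnS xj andbT -e0_min; apply/eqP.
  have := paK _ ex px; have := paK _ e0_edge e0_pa => pe pE.
  have K y z : edge y -> edge z -> pa y != 0 -> pa z != 0 -> pa y = pa z -> y = z.
    by move=> ey ez py pz E; rewrite -(paK _ ey) // E paK.
  have e1 := pa_edge _ e0_edge e0_pa.
  rewrite /minn; case: ifP => _; case: ifP => _ E.
  + by rewrite E eqxx in xe.
  + by move: pxe; rewrite E pe eqxx.
  + by rewrite E eqxx in pxe.
  + by rewrite (K _ _ ex e0_edge px e0_pa E) eqxx in xe.
Qed.

End Forcing.
End Propagation.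

(** * Reasoning about programs *)

(** A finite list of registers lets single steps be evaluated by simplification; registers past its
    end hold 0. *)
Definition St (l : seq nat) (M : nat -> nat) := State (nth 0 l) M.

(* The post-condition speaks of the total time elapsed, [t] being the time
   elapsed before [p] starts. *)
Definition wp W p t l M (Q : nat -> seq nat -> (nat -> nat) -> Prop) : Prop :=
  fits W (St l M) -> exists T l' M',
    [/\ exec W p (St l M) T (St l' M'), fits W (St l' M') & Q (t + T) l' M'].

Lemma upd_nth l i x : upd (nth 0 l) i x = nth 0 (set_nth 0 l i x).
Proof. by apply/funext => j; rewrite nth_set_nth. Qed.

Lemma fits_set_nth {W l M} r x : fits W (St l M) -> x < W ->
  fits W (St (set_nth 0 l r x) M).
Proof.
case=> fl fM xW; split=> // i; rewrite /= nth_set_nth /=.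
by case: eqP => // _; exact: fl.
Qed.

Section Rules.

Variables (W t : nat) (l : seq nat) (M : nat -> nat).
Variable Q : nat -> seq nat -> (nat -> nat) -> Prop.

Lemma wp_skip : Q t.+1 l M -> wp W PSkip t l M Q.
Proof. by move=> q ft; exists 1, l, M; rewrite addn1; split=> //; exact: ExecSkip. Qed.

Lemma wp_seq p q :
  wp W p t l M (fun t' l' M' => wp W q t' l' M' Q) -> wp W (PSeq p q) t l M Q.
Proof.
move=> H /H[T [l' [M' [ep ft /(_ ft)[T' [l'' [M'' [eq ft'' q'']]]]]]]].
exists (T + T'), l'', M''; rewrite addnA; split=> //; exact: ExecSeq ep eq.
Qed.

Lemma wp_if r p q :
  (nth 0 l r != 0 -> wp W p t.+1 l M Q) -> (nth 0 l r = 0 -> wp W q t.+1 l M Q) ->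
  wp W (PIf r p q) t l M Q.
Proof.
move=> Hp Hq ft; have [r0|r0] := eqVneq (nth 0 l r) 0.
  have [T [l' [M' [ex ft' qq]]]] := Hq r0 ft.
  by exists T.+1, l', M'; rewrite addnS -addSn; split=> //; exact: ExecIfFalse.
have [T [l' [M' [ex ft' qq]]]] := Hp r0 ft.
by exists T.+1, l', M'; rewrite addnS -addSn; split=> //; exact: ExecIfTrue.
Qed.

Lemma wp_do i l' M' : exec_instr i (St l M) = St l' M' ->
  (fits W (St l M) -> fits W (St l' M')) -> Q t.+1 l' M' -> wp W (PDo i) t l M Q.
Proof.
move=> E ft' q ft; exists 1, l', M'; rewrite addn1; split=> //; last exact: ft'.
by rewrite -E; apply: ExecDo; rewrite E; exact: ft'.
Qed.

Lemma wp_set i r x : exec_instr i (St l M) = set_reg (St l M) r x ->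
  (fits W (St l M) -> x < W) -> Q t.+1 (set_nth 0 l r x) M -> wp W (PDo i) t l M Q.
Proof.
move=> E xW; apply: wp_do; first by rewrite E /set_reg /= upd_nth.
by move=> ft; apply: fits_set_nth => //; exact: xW.
Qed.

Lemma wp_const r x : x < W -> Q t.+1 (set_nth 0 l r x) M ->
  wp W (PDo (IConst r x)) t l M Q.
Proof. by move=> xW; exact: wp_set. Qed.

Lemma wp_move r a : Q t.+1 (set_nth 0 l r (nth 0 l a)) M ->
  wp W (PDo (IMove r a)) t l M Q.
Proof. by apply: wp_set => // -[+ _]; exact. Qed.

Lemma wp_add r a b : nth 0 l a + nth 0 l b < W ->
  Q t.+1 (set_nth 0 l r (nth 0 l a + nth 0 l b)) M ->
  wp W (PDo (IAdd r a b)) t l M Q.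
Proof. by move=> xW; exact: wp_set. Qed.

Lemma wp_sub r a b : Q t.+1 (set_nth 0 l r (nth 0 l a - nth 0 l b)) M ->
  wp W (PDo (ISub r a b)) t l M Q.
Proof.
apply: wp_set => // -[/= /(_ a) + _]; exact: leq_ltn_trans (leq_subr _ _).
Qed.

Lemma wp_mul r a b : nth 0 l a * nth 0 l b < W ->
  Q t.+1 (set_nth 0 l r (nth 0 l a * nth 0 l b)) M ->
  wp W (PDo (IMul r a b)) t l M Q.
Proof. by move=> xW; exact: wp_set. Qed.

Lemma wp_read r a : Q t.+1 (set_nth 0 l r (M (nth 0 l a))) M ->
  wp W (PDo (IRead r a)) t l M Q.
Proof. by apply: wp_set => // -[_]; exact. Qed.

Lemma wp_write a b : Q t.+1 l (upd M (nth 0 l a) (nth 0 l b)) ->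
  wp W (PDo (IWrite a b)) t l M Q.
Proof.
apply: wp_do => // -[/= fl fM]; split=> // i /=; rewrite /upd.
by case: eqP => // _; exact: fl.
Qed.

End Rules.

(** The invariant keeps the elapsed time below [K] while every iteration increases it, so [K - t] is
    a termination measure and the time bound comes with it. *)
Lemma wp_while W r p Q (I : nat -> seq nat -> (nat -> nat) -> Prop) K :
  (forall t l M, I t l M -> t <= K) ->
  (forall t l M, I t l M -> nth 0 l r != 0 -> wp W p t.+1 l M I) ->
  (forall t l M, I t l M -> nth 0 l r = 0 -> Q t.+1 l M) ->
  forall t l M, I t l M -> wp W (PWhile r p) t l M Q.
Proof.
move=> IK Ip IQ t l M; have [d] := ubnP (K - t); elim: d t l M => // d IH t l M.
move=> td It ft; have [r0|r0] := eqVneq (nth 0 l r) 0.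
  by exists 1, l, M; rewrite addn1; split=> //; [exact: ExecWhileStop | exact: IQ].
have [T [l' [M' [ex ft' I']]]] := Ip _ _ _ It r0 ft.
have tK := IK _ _ _ It; have tK' := IK _ _ _ I'.
have lt : K - (t.+1 + T) < d by lia.
have [T' [l'' [M'' [ex' ft'' q]]]] := IH _ _ _ lt I' ft'.
exists (T + T').+1, l'', M''; rewrite addnS -addSn addnA; split=> //.
exact: ExecWhileLoop ex ex'.
Qed.

(** * The program *)

Definition block := foldr PSeq PSkip.

(* Registers 0-8 hold the answer, n, m, the bases of the arrays [old], [new] and
   of the stack, and the constants 1, 6, 2; register 9 is the edge counter, 10
   the condition of the outer loop, 11 the edge to be forced, 12 the success flag,
   13 the size of the stack, 14-22 are scratch. Edges are numbered from 1, so that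
   edge [x] is described from address [6 x - 4] on. *)

Definition clear_code := block
  [:: PDo (IMove 14 1);
      PWhile 14 (block
        [:: PDo (ISub 14 14 6); PDo (IAdd 15 4 14); PDo (IConst 16 0);
            PDo (IWrite 15 16)])].

Definition push_code := block
  [:: PDo (IAdd 16 3 15); PDo (IRead 16 16);
      PIf 16 (block
        [:: PDo (IMul 16 16 7); PDo (ISub 16 16 8); PDo (IRead 16 16);
            PDo (IAdd 17 5 13); PDo (IWrite 17 16); PDo (IAdd 13 13 6)]) PSkip].

(** Equality is tested by adding the two truncated differences, which gives 0 exactly for equal
    numbers. On a conflict, setting the stack size to 0 ends the loop. *)
Definition force_code := block
  [:: PDo (ISub 13 13 6); PDo (IAdd 14 5 13); PDo (IRead 14 14);
      PDo (IMul 17 14 7); PDo (ISub 17 17 8); PDo (ISub 17 17 8);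
      PDo (IRead 15 17); PDo (IAdd 17 17 6); PDo (IRead 18 17);
      PDo (IAdd 16 4 15); PDo (IRead 19 16);
      PDo (IAdd 17 4 18); PDo (IRead 20 17);
      PDo (ISub 21 19 14); PDo (ISub 22 14 19); PDo (IAdd 21 21 22);
      PIf 21 (block
        [:: PDo (IAdd 19 19 20);
            PIf 19 (block [:: PDo (IConst 12 0); PDo (IConst 13 0)])
              (block [:: PDo (IWrite 16 14); PDo (IWrite 17 14);
                         push_code; PDo (IMove 15 18); push_code])]) PSkip].

Definition commit_code := block
  [:: PDo (IMove 14 1);
      PWhile 14 (block
        [:: PDo (ISub 14 14 6); PDo (IAdd 15 3 14); PDo (IAdd 16 4 14);
            PDo (IRead 17 16);
            PIf 17 (PDo (IWrite 15 17)) (block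
              [:: PDo (IRead 18 15);
                  PIf 18 (block
                    [:: PDo (IMul 19 18 7); PDo (ISub 19 19 8); PDo (IRead 19 19);
                        PDo (IMul 20 19 7); PDo (ISub 20 20 8); PDo (ISub 20 20 8);
                        PDo (IRead 20 20); PDo (IAdd 20 4 20); PDo (IRead 20 20);
                        PDo (ISub 21 20 19); PDo (ISub 22 19 20);
                        PDo (IAdd 21 21 22);
                        PIf 21 PSkip
                          (block [:: PDo (IConst 22 0); PDo (IWrite 15 22)])])
                    PSkip])])].

Definition insert_code := block
  [:: clear_code; PDo (IWrite 5 11); PDo (IConst 12 1); PDo (IConst 13 1);
      PWhile 13 force_code; PIf 12 commit_code PSkip].

(** Register 10 ends up as the number of remaining edges times the answer, so the loop stops after
    the last edge or at the first failure. *)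
Definition pair_code := block
  [:: PDo (IMul 14 9 7); PDo (ISub 14 14 8); PDo (IRead 14 14); PDo (ISub 15 14 9);
      PIf 15 (block
        [:: PDo (IMove 11 9); insert_code;
            PIf 12 PSkip (block
              [:: PDo (IMul 14 9 7); PDo (ISub 14 14 8); PDo (IRead 11 14);
                  insert_code]);
            PDo (IMove 0 12)]) PSkip;
      PDo (ISub 10 2 9); PDo (IAdd 9 9 6); PDo (IMul 10 10 0)].

(** The flags overwrite the input. The flag of edge [j] goes to address [j - 1], below the
    descriptions of [j] and of all later edges, so nothing is lost before it is read. *)
Definition output_code := block
  [:: PDo (IMul 14 9 7); PDo (ISub 14 14 8); PDo (ISub 14 14 8); PDo (IRead 14 14);
      PDo (IAdd 14 3 14); PDo (IRead 14 14);
      PDo (ISub 15 14 9); PDo (ISub 16 9 14); PDo (IAdd 15 15 16);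
      PDo (ISub 15 6 15); PDo (ISub 16 9 6); PDo (IWrite 16 15);
      PDo (ISub 10 2 9); PDo (IAdd 9 9 6)].

(** Register 0 is initially 0 and serves as the address of [n]. The output loop also runs after a
    failure, when its result is ignored. *)
Definition partition_code := block
  [:: PDo (IRead 1 0); PDo (IConst 6 1); PDo (IRead 2 6); PDo (IConst 7 6);
      PDo (IConst 8 2); PDo (IMul 3 2 7); PDo (IAdd 3 3 8); PDo (IAdd 4 3 1);
      PDo (IAdd 5 4 1); PDo (IConst 0 1); PDo (IConst 9 1); PDo (IMove 10 2);
      PWhile 10 pair_code;
      PDo (IConst 9 1); PDo (IMove 10 2); PWhile 10 output_code].

Ltac step := first [ apply: wp_seq | apply: wp_skip | apply: wp_move
  | apply: wp_sub | apply: wp_read | apply: wp_write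
  | apply: wp_const; first try lia | apply: wp_add; first (rewrite /=; try lia)
  | apply: wp_mul; first (rewrite /=; try lia) ]; rewrite /=.

Ltac steps := repeat step.

(** * Correctness and running time of the program *)

Section Execution.

Variables (W n m : nat) (inp : nat -> nat).

Notation A := (m * 6 + 2).
Notation B := (A + n).
Notation C := (B + n).

(** The addresses are written as the code computes them, subtracting the constant 2 twice. *)
Definition sr x := inp (x * 6 - 2 - 2).
Definition tg x := inp (x * 6 - 2 - 2 + 1).
Definition pa x := inp (x * 6 - 2).

Hypothesis W_large : m * 6 + n * 3 + 30 < W.
Hypothesis inp0 : inp 0 = n.
Hypothesis inp1 : inp 1 = m.
Hypothesis sr_lt : forall x, edge m x -> sr x < n.
Hypothesis tg_lt : forall x, edge m x -> tg x < n.
Hypothesis sr_tg : forall x, edge m x -> sr x != tg x.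
Hypothesis pa_edge : forall x, edge m x -> pa x != 0 -> edge m (pa x).
Hypothesis paK : forall x, edge m x -> pa x != 0 -> pa (pa x) = x.
Hypothesis pa_neq : forall x, edge m x -> pa x != x.

Record rep (M old new : nat -> nat) (stk : seq nat) : Prop := Rep {
  rep_inp : forall a, a < A -> M a = inp a;
  rep_old : forall v, v < n -> M (A + v) = old v;
  rep_new : forall v, v < n -> M (B + v) = new v;
  rep_stk : forall i, i < size stk -> M (C + i) = nth 0 stk i }.

Lemma rep_upd_old M old new stk v x :
  rep M old new stk -> v < n -> rep (upd M (A + v) x) (upd old v x) new stk.
Proof.
case=> ri ro rn rs vn; split=> i il; rewrite /upd.
- by case: eqP => [|_]; [lia | exact: ri].
- by rewrite eqn_add2l; case: eqP => // _; exact: ro.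
- by case: eqP => [|_]; [lia | exact: rn].
- by case: eqP => [|_]; [lia | exact: rs].
Qed.

Lemma rep_upd_new M old new stk v x :
  rep M old new stk -> v < n -> rep (upd M (B + v) x) old (upd new v x) stk.
Proof.
case=> ri ro rn rs vn; split=> i il; rewrite /upd.
- by case: eqP => [|_]; [lia | exact: ri].
- by case: eqP => [|_]; [lia | exact: ro].
- by rewrite eqn_add2l; case: eqP => // _; exact: rn.
- by case: eqP => [|_]; [lia | exact: rs].
Qed.

Lemma rep_push M old new stk x :
  rep M old new stk -> rep (upd M (C + size stk) x) old new (rcons stk x).
Proof.
case=> ri ro rn rs; split=> i il; rewrite /upd.
- by case: eqP => [|_]; [lia | exact: ri].
- by case: eqP => [|_]; [lia | exact: ro].
- by case: eqP => [|_]; [lia | exact: rn].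
- rewrite eqn_add2l nth_rcons; case: eqP => [->|ne]; first by rewrite ltnn.
  by rewrite size_rcons in il; rewrite ifT ?rs //; lia.
Qed.

Lemma rep_pop M old new stk x : rep M old new (rcons stk x) ->
  rep M old new stk /\ M (C + size stk) = x.
Proof.
case=> ri ro rn rs; split; last by rewrite rs ?size_rcons // nth_rcons ltnn eqxx.
split=> // i il; rewrite rs ?size_rcons ?nth_rcons ?il //; lia.
Qed.

Lemma rep_nil M old new stk : rep M old new stk -> rep M old new [::].
Proof. by case=> ri ro rn _; split. Qed.

Section Rep.
Variables (M old new : nat -> nat) (stk : seq nat).
Hypothesis rM : rep M old new stk.

Lemma rep_sr x : edge m x -> M (x * 6 - 2 - 2) = sr x.
Proof. by case/andP=> x0 xm; rewrite (rep_inp _ _ _ _ rM) //; lia. Qed.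

Lemma rep_tg x : edge m x -> M (x * 6 - 2 - 2 + 1) = tg x.
Proof. by case/andP=> x0 xm; rewrite (rep_inp _ _ _ _ rM) //; lia. Qed.

Lemma rep_pa x : edge m x -> M (x * 6 - 2) = pa x.
Proof. by case/andP=> x0 xm; rewrite (rep_inp _ _ _ _ rM) //; lia. Qed.
End Rep.

Definition regs acc e r e0 fl sz ts :=
  [:: acc; n; m; A; B; C; 1; 6; 2; e; r; e0; fl; sz] ++ ts.

Section Subroutines.

Variables (acc e r : nat).
Local Notation post := (nat -> seq nat -> (nat -> nat) -> Prop).

Lemma wp_clear t e0 fl sz ts M old new (Q : post) :
  size ts = 9 -> rep M old new [::] ->
  (forall t' ts' M' new', size ts' = 9 -> t' <= t + 6 * n + 5 ->
     rep M' old new' [::] -> (forall v, v < n -> new' v = 0) ->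
     Q t' (regs acc e r e0 fl sz ts') M') ->
  wp W clear_code t (regs acc e r e0 fl sz ts) M Q.
Proof.
case: ts => [|a1 [|a2 [|a3 [|a4 [|a5 [|a6 [|a7 [|a8 [|a9 [|//]]]]]]]]]] //= _ rM HQ.
rewrite /clear_code /=; do 2 step; step.
(* The counter runs downwards, the cells from [i] on are clear, and an iteration costs six steps. *)
pose I t' l M' := exists i b2 b3 new', [/\ i <= n,
  l = regs acc e r e0 fl sz [:: i; b2; b3; a4; a5; a6; a7; a8; a9],
  rep M' old new' [::], forall v, i <= v < n -> new' v = 0
  & t' + 6 * i <= t + 6 * n + 1].
apply: (wp_while _ _ _ _ I (t + 6 * n + 1)).
- by move=> t' l M' [i [b2 [b3 [new' [_ _ _ _]]]]]; lia.
- move=> t' _ M' [i [b2 [b3 [new' [il -> rM' new0 tl]]]]] /= i0.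
  steps; exists (i - 1), (B + (i - 1)), 0, (upd new' (i - 1) 0); split=> //.
  + lia.
  + by apply: rep_upd_new => //; lia.
  + by move=> v vl; rewrite /upd; case: eqP => // ?; apply: new0; lia.
  + lia.
- move=> t' _ M' [i [b2 [b3 [new' [il -> rM' new0 tl]]]]] /= i0.
  step; apply: HQ rM' _ => //; first by lia.
  by move=> v vn; apply: new0; lia.
- exists n, a2, a3, new; split=> //; [by move=> v; lia | lia].
Qed.

Lemma wp_push t e0 fl x v a3 a4 a5 a6 a7 a8 a9 M old new stk (Q : post) :
  v < n -> (old v != 0 -> edge m (old v)) ->
  rep M old new stk -> size (stk ++ pushed pa old v) <= n.+1 ->
  (forall t' b3 b4 M', t' <= t + 12 -> rep M' old new (stk ++ pushed pa old v) ->
     Q t' (regs acc e r e0 fl (size (stk ++ pushed pa old v))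
             [:: x; v; b3; b4; a5; a6; a7; a8; a9]) M') ->
  wp W push_code t
    (regs acc e r e0 fl (size stk) [:: x; v; a3; a4; a5; a6; a7; a8; a9]) M Q.
Proof.
move=> vn ov rM sz HQ; rewrite /push_code /=; do 4 step; step.
rewrite (rep_old _ _ _ _ rM) //; apply: wp_if => /= o0.
  have /andP[od0 odm] := ov o0.
  rewrite /pushed (negPf o0) cats1 in sz HQ *.
  rewrite size_rcons in sz HQ.
  steps; rewrite addn1; apply: HQ; first by lia.
  by rewrite (rep_pa _ _ _ _ rM) ?ov //; apply: rep_push.
do 2 step; rewrite /pushed o0 eqxx cats0 in HQ *; apply: HQ => //; lia.
Qed.


Section Insertion.

Variables (j e0 : nat) (old : nat -> nat).
Hypothesis old_settled : settled n m sr tg pa j old.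
Hypotheses (e0_edge : edge m e0) (e0_pa : pa e0 != 0) (e0_min : minn e0 (pa e0) = j).

Notation forced := (forcing n m sr tg pa e0 old).
Notation refuted := (forall S, solution m sr tg pa S -> ~~ S e0).

Let old_edge v : v < n -> old v != 0 -> edge m (old v).
Proof. by case: old_settled => occ _ _ vn /(occ _ vn)[]. Qed.

(** The stack size plus the vacancies drops by at least one per iteration, paying for 60 steps. Its
    bound [n + 1] also keeps the stack addresses below [W]. *)
Lemma wp_force (K t : nat) (l : seq nat) (M : nat -> nat) :
  let I (t : nat) (l : seq nat) (M : nat -> nat) := exists fl stk new ts,
    [/\ size ts = 9 /\ l = regs acc e r e0 fl (size stk) ts,
        rep M old new stk, size stk + vacancies n new <= n.+1,
        (fl = 1 /\ forced new stk) \/ [/\ fl = 0, stk = [::] & refuted]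
      & t + 60 * (size stk + vacancies n new) <= K] in
  I t l M -> nth 0 l 13 != 0 -> wp W force_code t.+1 l M I.
Proof.
move=> I [fl [stk [new [ts [[sts ->] rM sz inv tK]]]]] /= stk0.
case: inv => [[fl1 frc]|[_ E _]]; last by rewrite E in stk0.
case: ts sts => [|a1 [|a2 [|a3 [|a4 [|a5 [|a6 [|a7 [|a8 [|a9 [|//]]]]]]]]]] //= _.
case/lastP: stk rM sz frc tK stk0 => // s x rM sz frc tK _.
have [rs Mx] := rep_pop _ _ _ _ _ rM.
rewrite size_rcons in sz tK *.
have ex : edge m x by case: frc => _ _ + _ _; apply; rewrite mem_rcons inE eqxx.
have /andP[x0 xm] := ex.
have [srn tgn] := (sr_lt _ ex, tg_lt _ ex).
rewrite /force_code /=; do 2 step; rewrite subn1 succnK; do 4 step.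
rewrite Mx; do 8 step; rewrite (rep_sr _ _ _ _ rs) //; do 4 step.
rewrite (rep_tg _ _ _ _ rs) //; do 4 step; rewrite (rep_new _ _ _ _ rs) //.
do 4 step; rewrite (rep_new _ _ _ _ rs) //.
have [sx|nsx] := boolP (selected sr new x).
  rewrite (eqP sx); steps; apply: wp_if => /=; first by rewrite subnn.
  move=> _; steps; exists fl, s, new; eexists; split.
  - by split; last reflexivity.
  - exact: rs.
  - lia.
  - by left; split=> //; apply: forcing_pop sx frc.
  - lia.
have xE : new (sr x) <> x by apply/eqP.
have nocc : occupancy n m sr tg new by case: frc.
have nsm := occupancy_le _ _ _ _ nocc srn; have ntm := occupancy_le _ _ _ _ nocc tgn.
steps; apply: wp_if => /= [_|d0]; last by lia.
do 2 step; step; apply: wp_if => /= nn.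
  steps; exists 0, [::], new; eexists; split.
  - by split; last reflexivity.
  - exact: rep_nil rs.
  - by rewrite (leq_trans (vacancies_le _ _)).
  - by right; split=> //; apply: forcing_conflict frc nsx nn.
  - by move: tK (vacancies_le n new); rewrite /=; lia.
have [ns nt] : new (sr x) = 0 /\ new (tg x) = 0 by lia.
have vac := vacancies_occupy _ _ _ _ sr_lt tg_lt sr_tg _ _ ex ns nt.
have frc' := forcing_occupy _ _ _ _ _ sr_lt tg_lt pa_edge paK _ _ _ old_settled
  e0_edge e0_min _ _ _ frc ns nt.
have sp v : size (pushed pa old v) <= 1 by rewrite /pushed; case: ifP.
have [sp1 sp2] := (sp (sr x), sp (tg x)).
have rs' := rep_upd_new _ _ _ _ _ x (rep_upd_new _ _ _ _ _ x rs srn) tgn.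
do 5 step; apply: wp_push rs' _ _ => //; first exact: old_edge.
- by rewrite size_cat; lia.
move=> t' b3 b4 M' tt' rM'; do 3 step; apply: wp_push rM' _ _ => //; first exact: old_edge.
- by rewrite !size_cat; lia.
move=> t'' c3 c4 M'' tt'' rM''; steps.
exists fl, ((s ++ pushed pa old (sr x)) ++ pushed pa old (tg x)), (occupy sr tg new x).
eexists; split.
- by split; last reflexivity.
- exact: rM''.
- by rewrite !size_cat; lia.
- by left.
- by rewrite !size_cat; lia.
Qed.

Lemma wp_force_loop t fl stk ts M new (Q : post) :
  size ts = 9 -> rep M old new stk -> size stk + vacancies n new <= n.+1 ->
  fl = 1 -> forced new stk ->
  (forall t' ts' fl' M' new', size ts' = 9 -> t' <= t + 60 * n + 61 ->
     rep M' old new' [::] ->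
     (fl' = 1 /\ forced new' [::]) \/ (fl' = 0 /\ refuted) ->
     Q t' (regs acc e r e0 fl' 0 ts') M') ->
  wp W (PWhile 13 force_code) t (regs acc e r e0 fl (size stk) ts) M Q.
Proof.
move=> sts rM sz fl1 frc HQ.
apply: (wp_while _ _ _ _ _ (t + 60 * n + 60) _ (wp_force (t + 60 * n + 60))).
- by move=> t' l M' [? [? [? [? [_ _ _ _]]]]]; lia.
- move=> t' l M' [fl' [stk' [new' [ts' [[sts' ->] rM' _ inv tK]]]]] /= /size0nil sk.
  rewrite sk in rM' inv tK *; apply: HQ rM' _ => //; first by lia.
  by case: inv => [|[]]; [left|right].
- exists fl, stk, new, ts; split=> //; [by left | lia].
Qed.

Lemma commit_value new f v : v < n -> f v = old v -> 
  commit sr pa old new v =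
  if new v != 0 then new v else if f v != 0 then
    if new (sr (pa (f v))) == pa (f v) then 0 else f v
  else f v.
Proof. by move=> vn ->; rewrite /commit /selected; do 2 case: eqP => //=. Qed.

(** The update can be done in place: the new entry at [v] depends on [old] only through [old v], so
    no overwritten cell is consulted. *)
Lemma wp_commit t fl sz ts M new (Q : post) :
  size ts = 9 -> rep M old new [::] -> occupancy n m sr tg new ->
  (forall t' ts' M' f, size ts' = 9 -> t' <= t + 30 * n + 10 -> rep M' f new [::] ->
     (forall v, v < n -> f v = commit sr pa old new v) ->
     Q t' (regs acc e r e0 fl sz ts') M') ->
  wp W commit_code t (regs acc e r e0 fl sz ts) M Q.
Proof.
case: ts => [|a1 [|a2 [|a3 [|a4 [|a5 [|a6 [|a7 [|a8 [|a9 [|//]]]]]]]]]] //= _ rM nocc HQ.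
rewrite /commit_code /=; do 2 step; step.
pose I t' l M' := exists i ts' f, [/\ size ts' = 8 /\ i <= n,
  l = regs acc e r e0 fl sz (i :: ts'), rep M' f new [::],
  forall v, v < n -> f v = if v < i then old v else commit sr pa old new v
  & t' + 30 * i <= t + 30 * n + 1].
apply: (wp_while _ _ _ _ I (t + 30 * n + 1)).
- by move=> t' l M' [i [ts' [f [_ _ _ _]]]]; lia.
- move=> t' _ M' [i [ts' [f [[sts il] -> rM' fE tl]]]] /= i0.
  case: ts' sts => [|b2 [|b3 [|b4 [|b5 [|b6 [|b7 [|b8 [|b9 [|//]]]]]]]]] //= _.
  have vn : i - 1 < n by lia.
  have fo : f (i - 1) = old (i - 1) by rewrite fE // ifT //; lia.
  have cE := commit_value new f _ vn fo.
  have commit_step t'' ts' g M'' : size ts' = 8 -> t'' <= t'.+2 + 27 -> rep M'' g new [::] ->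
      (forall v, v < n -> g v = if v == i - 1 then commit sr pa old new v else f v) ->
      I t'' (regs acc e r e0 fl sz (i - 1 :: ts')) M''.
    move=> sts tt rg gE; exists (i - 1), ts', g; split=> //; [by split=> //; lia| |lia].
    move=> v vn'; rewrite gE //; case: eqP => [->|vi]; first by rewrite ltnn.
    by rewrite fE //; congr (if _ then _ else _); lia.
  have updE x : x = commit sr pa old new (i - 1) -> forall v, v < n ->
      upd f (i - 1) x v = if v == i - 1 then commit sr pa old new v else f v.
    by move=> -> v _; rewrite /upd; case: eqP => [->|].
  have keepE : f (i - 1) = commit sr pa old new (i - 1) -> forall v, v < n ->
      f v = if v == i - 1 then commit sr pa old new v else f v.
    by move=> E v _; case: eqP => [->|].
  steps; rewrite (rep_new _ _ _ _ rM') //.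
  apply: wp_if => /= nv.
    steps; apply: commit_step; last 1 [by apply: updE; rewrite cE nv] => //; first by lia.
    exact: rep_upd_old.
  rewrite nv /= in cE.
  do 2 step; rewrite (rep_old _ _ _ _ rM') //; step.
  apply: wp_if => /= ov; last first.
    rewrite ov /= in cE; steps; apply: commit_step; last 1 [by apply: keepE; rewrite cE ov] => //.
    by lia.
  rewrite ov in cE; rewrite fo in ov cE *.
  have eo := old_edge _ vn ov; have /andP[_ om] := eo.
  have [oocc osel _] := old_settled.
  have [po _] := osel _ eo (occupancy_selected _ _ _ _ oocc vn ov).
  have ep := pa_edge _ eo po; have /andP[_ pm] := ep.
  have sn := sr_lt _ ep; have nm := occupancy_le _ _ _ _ nocc sn.
  do 6 step; rewrite (rep_pa _ _ _ _ rM') //.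
  do 8 step; rewrite (rep_sr _ _ _ _ rM') //.
  do 4 step; rewrite (rep_new _ _ _ _ rM') //.
  steps; apply: wp_if => /= d.
    steps; apply: commit_step; last 1 [apply: keepE; rewrite cE ifN ?fo //; lia] => //;
      first by lia.
  steps; apply: commit_step; last 1 [apply: (updE 0); rewrite cE ifT //; lia] => //;
      first by lia.
  exact: rep_upd_old.
- move=> t' _ M' [i [ts' [f [[sts il] -> rM' fE tl]]]] /= i0.
  step; apply: (HQ _ (i :: ts')) rM' _ => //; [by rewrite /= sts | by lia|].
  by move=> v vn; rewrite fE // i0.
- exists n, [:: a2; a3; a4; a5; a6; a7; a8; a9], old; split=> //; [by move=> v -> | lia].
Qed.

(** A failed insertion has written only to [new] and the stack, so the other edge of the pair can be
    tried from the same [old]. *)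
Lemma wp_insert t fl sz ts M new (Q : post) :
  size ts = 9 -> rep M old new [::] ->
  (forall t' ts' fl' M' new' f, size ts' = 9 -> t' <= t + 100 * n.+1 ->
     rep M' f new' [::] ->
     (fl' = 1 /\ settled n m sr tg pa j.+1 f) \/ [/\ fl' = 0, f = old & refuted] ->
     Q t' (regs acc e r e0 fl' 0 ts') M') ->
  wp W insert_code t (regs acc e r e0 fl sz ts) M Q.
Proof.
move=> sts rM HQ; rewrite /insert_code /=; step; apply: wp_clear rM _ => //.
move=> t1 ts1 M1 new1 s1 tt1 rM1 new0; do 7 step.
have /= rM1' := rep_push _ _ _ _ e0 rM1; rewrite addn0 in rM1'.
apply: (wp_force_loop _ 1 [:: e0]) rM1' _ _ _ _ => //.
- by have := vacancies_le n new1; rewrite /=; lia.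
- exact: forcing_init.
move=> t2 ts2 fl2 M2 new2 s2 tt2 rM2 inv; step; apply: wp_if => /= fl0.
  have [[_ frc]|[fl20 _]] := inv; last by rewrite fl20 in fl0.
  apply: wp_commit rM2 _ _ => //; first by case: frc.
  move=> t3 ts3 M3 f s3 tt3 rM3 fE; step; apply: HQ rM3 _ => //; first by lia.
  left; split; first by case: inv => [[]|[fl20]]; rewrite ?fl20 in fl0 *.
  exact: settled_commit frc _ fE.
do 2 step; apply: HQ rM2 _ => //; first by lia.
by case: inv => [[fl1 _]|[_ ref]]; [rewrite fl1 in fl0 | right].
Qed.

End Insertion.

End Subroutines.

(** Every edge is charged 40 steps, and every pair [250 * n.+1] more, enough for two insertions. *)
Lemma wp_pair (K t : nat) (l : seq nat) (M : nat -> nat) :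
  let I (t : nat) (l : seq nat) (M : nat -> nat) :=
    exists j acc r e0 fl sz ts old new,
    [/\ size ts = 9 /\ 0 < j <= m.+1,
        l = regs acc j r e0 fl sz ts /\ r = (m.+1 - j) * acc,
        rep M old new [::] /\ occupancy n m sr tg old,
        [/\ acc = 1, settled n m sr tg pa j old
          & t + 40 * (m.+1 - j) + 250 * n.+1 * (n.+1 - pairs pa j) <= K] \/
        (acc = 0 /\ forall S, ~ solution m sr tg pa S)
      & t <= K] in
  I t l M -> nth 0 l 10 != 0 -> wp W pair_code t.+1 l M I.
Proof.
move=> I [j [acc [r [e0 [fl [sz [ts [old [new [[sts j1] [-> rE] [rM _] inv tK]]]]]]]]]] /= r0.
case: inv => [[acc1 set tb]|[acc0 _]]; last by rewrite rE acc0 muln0 in r0.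
rewrite acc1 muln1 in rE; rewrite {}acc1 {}rE in r0 *.
case: ts sts => [|a1 [|a2 [|a3 [|a4 [|a5 [|a6 [|a7 [|a8 [|a9 [|//]]]]]]]]]] //= _.
have ej : edge m j by rewrite /edge; lia.
have occ : occupancy n m sr tg old by case: set.
have pn := pairs_le _ _ _ _ _ sr_lt pa_edge paK _ _ set (proj2 (andP j1)).
(* At most [n] pairs have been inserted, so out of [n + 1] charges one is left for this pair, even
   if it fails. *)
have [q qE] : exists q, n.+1 - pairs pa j = q.+1 by exists (n - pairs pa j); lia.
rewrite qE mulnS in tb.
have fin t' acc' e0' fl' sz' ts' M' f new' : size ts' = 9 ->
    rep M' f new' [::] -> occupancy n m sr tg f ->
    [/\ acc' = 1, settled n m sr tg pa j.+1 f
      & t' + 40 * (m - j) + 250 * n.+1 * (n.+1 - pairs pa j.+1) + 10 <= K] \/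
    (acc' = 0 /\ forall S, ~ solution m sr tg pa S) ->
    t' + 10 <= K ->
    wp W (block [:: PDo (ISub 10 2 9); PDo (IAdd 9 9 6); PDo (IMul 10 10 0)]) t'
      (regs acc' j (m.+1 - j) e0' fl' sz' ts') M' I.
  move=> sts' rM' occ' inv' tK'; rewrite /=; do 5 step.
  step; first by case: inv' => [[->]|[->]]; lia.
  step; exists j.+1, acc', ((m - j) * acc'), e0', fl', sz', ts', f, new'; split.
  - by split=> //; lia.
  - by rewrite addn1 subSS.
  - by [].
  - case: inv' => [[-> ? ?]|]; [left; split=> // | by right].
    by rewrite subSS; lia.
  - lia.
rewrite /pair_code /=; do 6 step; rewrite (rep_pa _ _ _ _ rM) //.
do 3 step; apply: wp_if => /= jp; last first.
  have npj : ~~ (j < pa j) by lia.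
  step; apply: fin rM _ _ _ => //; last by lia.
  left; split=> //; first exact: settledS.
  by rewrite pairsS ?(negPf npj) ?addn0 ?qE ?mulnS; lia.
have jpa : j < pa j by lia.
have pj0 : pa j != 0 by lia.
have jm : minn j (pa j) = j by lia.
have pE : 250 * n.+1 * (n.+1 - pairs pa j.+1) = 250 * n.+1 * q.
  by rewrite pairsS ?jpa; [congr (_ * _); lia | lia].
do 3 step; apply: (wp_insert _ _ _ j j old set) rM _ => //.
move=> t1 ts1 fl1 M1 new1 f1 s1 tt1 rM1 inv1; step; apply: wp_if => /= fl0.
  case: inv1 => [[fl11 set1]|[fl10 _ _]]; last by rewrite fl10 in fl0.
  do 4 step; apply: fin rM1 _ _ _ => //; [by case: set1 | | by lia].
  by left; split=> //; rewrite pE; lia.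
case: inv1 => [[fl11 _]|[_ f1E ref1]]; first by rewrite fl11 in fl0.
rewrite {}f1E in rM1.
case: ts1 s1 => [|b1 [|b2 [|b3 [|b4 [|b5 [|b6 [|b7 [|b8 [|b9 [|//]]]]]]]]]] //= _.
do 6 step; rewrite (rep_pa _ _ _ _ rM1) //.
step; apply: (wp_insert _ _ _ j (pa j) old set) rM1 _ => //.
- exact: pa_edge.
- by rewrite paK //; lia.
- by rewrite paK //; lia.
move=> t2 ts2 fl2 M2 new2 f2 s2 tt2 rM2 inv2; do 4 step.
case: inv2 => [[fl21 set2]|[fl20 f2E ref2]].
  apply: fin rM2 _ _ _ => //; [by case: set2 | | by lia].
  by left; split=> //; rewrite pE; lia.
apply: fin rM2 _ _ _ => //; [by rewrite f2E | | by lia].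
(* A solution contains one edge of the pair, but both have been refuted. *)
right; split=> // S Ssol; have := ref2 _ Ssol.
by rewrite (proj1 Ssol) // ref1.
Qed.

Lemma wp_output acc old M0 new : rep M0 old new [::] ->
  occupancy n m sr tg old -> forall (K t : nat) (l : seq nat) (M : nat -> nat),
  let I (t : nat) (l : seq nat) (M : nat -> nat) := exists j e0 fl sz ts,
    [/\ size ts = 9 /\ l = regs acc j (m.+1 - j) e0 fl sz ts,
        0 < j <= m.+1,
        forall a, j.-1 <= a -> M a = M0 a,
        forall x, x < j.-1 -> M x = selected sr old x.+1 :> nat
      & t + 40 * (m.+1 - j) <= K] in
  I t l M -> nth 0 l 10 != 0 -> wp W output_code t.+1 l M I.
Proof.
move=> rM0 occ K t l M I [j [e0 [fl [sz [ts [[sts ->] j1 MM0 Msel tK]]]]]] /= r0.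
case: ts sts => [|a1 [|a2 [|a3 [|a4 [|a5 [|a6 [|a7 [|a8 [|a9 [|//]]]]]]]]]] //= _.
have ej : edge m j by rewrite /edge; lia.
have sn := sr_lt _ ej; have om := occupancy_le _ _ _ _ occ sn.
rewrite /output_code /=; do 8 step.
rewrite MM0 ?(rep_sr _ _ _ _ rM0) //; last by lia.
do 4 step; rewrite MM0 ?(rep_old _ _ _ _ rM0) //; last by lia.
steps; exists j.+1, e0, fl, sz; eexists; split.
- by rewrite addn1 -(subSS j m); split; last reflexivity.
- lia.
- by move=> a ja; rewrite /upd; case: eqP => [|_]; [lia | apply: MM0; lia].
- move=> x xj; rewrite /upd; case: eqP => [->|xne]; last by apply: Msel; lia.
  rewrite subn1 prednK; last by lia.
  by rewrite /selected; case: eqP => [->|]; lia.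
- lia.
Qed.

Hypothesis inp_out : forall a, A <= a -> inp a = 0.

(** The quadratic term pays for the insertions, with [n + 1] charges of [250 * n.+1]; each of the
    two passes over the edges adds [40 * m]. *)
Lemma wp_partition : wp W partition_code 0 (nseq 23 0) inp (fun t l M =>
  t <= 250 * n.+1 ^ 2 + 80 * m + 60 /\
  ((nth 0 l 0 = 1 /\ exists2 old, settled n m sr tg pa m.+1 old &
      forall x, x < m -> M x = selected sr old x.+1 :> nat) \/
   (nth 0 l 0 = 0 /\ forall S, ~ solution m sr tg pa S))).
Proof.
rewrite /partition_code /=; do 2 step; rewrite inp0; do 4 step; rewrite inp1.
do 19 step.
apply: (wp_while _ _ _ _ _ _ _ (wp_pair (250 * n.+1 ^ 2 + 40 * m + 30))).
- by move=> t l M [? [? [? [? [? [? [? [? [? [_ _ _ _ tK]]]]]]]]]]; exact: tK.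
- move=> t l M [j [acc [r [e0 [fl [sz [ts [old [new H]]]]]]]]].
  case: H => [[sts j1] [-> rE] [rM occ] inv tK] /= r0.
  have inv' : acc = 1 /\ settled n m sr tg pa m.+1 old \/
      acc = 0 /\ forall S, ~ solution m sr tg pa S.
    case: inv => [[acc1 set _]|]; [left; split=> // | by right].
    (* With answer 1, the loop condition vanishes only once all edges are done. *)
    by have -> : m.+1 = j by rewrite rE acc1 in r0; lia.
  do 5 step.
  apply: (wp_while _ _ _ _ _ _ _
    (wp_output acc _ _ _ rM occ (250 * n.+1 ^ 2 + 80 * m + 40))).
  + by move=> t' l' M' [? [? [? [? [? [_ _ _ _ tK']]]]]]; apply: leq_trans tK'; exact: leq_addr.
  + move=> t' _ M' [j' [e0' [fl' [sz' [ts' [[sts' ->] j1' MM0 Msel tK']]]]]] /= r0'.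
    step; split; first by lia.
    case: inv' => [[acc1 set]|]; [left; split=> // | by right].
    by exists old => // x xm; apply: Msel; lia.
  + by exists 1, e0, fl, sz, ts; rewrite subn1; split=> //; lia.
- exists 1, 1, m, 0, 0, 0, (nseq 9 0), (fun=> 0), (fun=> 0); split=> //.
  + by rewrite subn1 muln1.
  + by split=> //; split=> // i il; rewrite inp_out //; lia.
  + left; split=> //; first exact: settled_init.
    by rewrite /pairs /= subn0 expnS expn1; lia.
  + by rewrite expnS expn1; lia.
Qed.

End Execution.

(** * Graphs and their encodings *)

Lemma nth_flatten_uniform {T : Type} (x0 : T) k (ss : seq (seq T)) i j :
  all (fun s => size s == k) ss -> i < size ss -> j < k ->
  nth x0 (flatten ss) (i * k + j) = nth x0 (nth [::] ss i) j.
Proof.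
move=> + + jk; elim: ss i => [|s ss IH] [|i] //= /andP[/eqP sk ssk] il.
  by rewrite nth_cat sk jk.
by rewrite mulSn -addnA nth_cat sk ltnNge leq_addr addKn IH.
Qed.

Section Encoding.

Variables (R : realType) (G : one_plane_graph R).

Notation n := (nv G).
Notation m := (ne G).
Notation P := (opg_plan G).
Notation inp := (nth 0 (encode G)).

Lemma partner_neq e f b : partner P e = Some (f, b) -> e != f.
Proof.
have [D [_ _ [Pt Pf _]]] := opg_drawable G.
by case: b => [/Pt|/Pf] []; rewrite // eq_sym.
Qed.

(** One leftward crossing relation gives the flag [true] at one edge and [false] at the other. *)
Lemma partner_sym e f b : partner P e = Some (f, b) -> exists b', partner P f = Some (e, b').
Proof.
have [D [_ _ [Pt Pf _]]] := opg_drawable G.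
by case: b => [/Pt|/Pf]; [exists false; apply/Pf | exists true; apply/Pt].
Qed.

(** A Jordan arc is injective, so its values at 0 and 1 differ. *)
Lemma src_neq_tgt (e : 'I_m) : src e != tgt e.
Proof.
have [D [[_ arcs _ _ _] _ _]] := opg_drawable G.
have [[_ inj] c0 c1] := arcs e; apply/eqP => st.
have := inj 0%R 1%R; rewrite c0 c1 st !in_itv /= lexx ler01 lexx.
by move=> /(_ isT isT erefl)/eqP; rewrite eq_sym oner_eq0.
Qed.

(** Two edges with the same source and the same target would meet in two points, so an edge is
    determined by its pair of ends. *)
Lemma ne_le : m <= n ^ 2.
Proof.
have [D [[_ arcs _ meet _] _ _]] := opg_drawable G.
have inj : injective (fun e : 'I_m => (src e, tgt e)).
  move=> e f [se te]; apply/eqP; apply: contraT => nef.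
  have [_ e0 e1] := arcs e; have [_ f0 f1] := arcs f.
  have I0 : ((0 : R) \in `[0, 1])%R by rewrite in_itv /= lexx ler01.
  have I1 : ((1 : R) \in `[0, 1])%R by rewrite in_itv /= lexx ler01.
  have [|||/eqP] := meet e f nef 0%R 0%R 1%R 1%R.
  - by split.
  - by rewrite e0 f0 se.
  - by rewrite e1 f1 te.
  by rewrite eq_sym oner_eq0.
by have := leq_card _ inj; rewrite card_prod !card_ord expnS expn1.
Qed.

Lemma size_encode : size (encode G) = m * 6 + 2.
Proof.
rewrite /encode size_cat size_flatten /shape -map_comp /= addnC; congr (_ + _).
rewrite (eq_map (g := fun=> 6)) // sumnE big_map big_const_seq count_predT.
by rewrite size_enum_ord iter_addn_0 mulnC.
Qed.

Lemma nth_encode (e : 'I_m) i : i < 6 ->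
  inp (e * 6 + i).+2 = nth 0 (encode_edge P e) i.
Proof.
move=> i6; rewrite /encode /= nth_flatten_uniform ?size_map ?size_enum_ord //.
  by rewrite (nth_map e) ?size_enum_ord // nth_ord_enum.
by rewrite all_map; apply/allP.
by rewrite -enumT size_enum_ord ltn_ord.
Qed.

Lemma edge_ordP x : edge m x -> exists e : 'I_m, x = e.+1.
Proof.
by case: x => [|x]; rewrite /edge // => xm; exists (Ordinal xm).
Qed.

Lemma sr_encode (e : 'I_m) : sr inp e.+1 = src e.
Proof. by rewrite /sr -[RHS](nth_encode e 0) //; congr nth; lia. Qed.

Lemma tg_encode (e : 'I_m) : tg inp e.+1 = tgt e.
Proof. by rewrite /tg -[RHS](nth_encode e 1) //; congr nth; lia. Qed.

Lemma pa_encode (e : 'I_m) :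
  pa inp e.+1 = if partner P e is Some (f, _) then f.+1 else 0.
Proof. by rewrite /pa -[RHS](nth_encode e 2) //; congr nth; lia. Qed.

Lemma pa_encodeP (e : 'I_m) : pa inp e.+1 != 0 ->
  exists f b, partner P e = Some (f, b) /\ pa inp e.+1 = f.+1.
Proof. by rewrite pa_encode; case: (partner P e) => // -[f b] _; exists f, b. Qed.

Lemma pa_partner {e f : 'I_m} {b} : partner P e = Some (f, b) -> pa inp e.+1 = f.+1.
Proof. by rewrite pa_encode => ->. Qed.

Lemma encode_lt a : inp a < m * 6 + n * 3 + 30.
Proof.
have [al|al] := ltnP a (size (encode G)); last by rewrite nth_default //; lia.
case: a al => [|[|a]] al; [by rewrite /=; lia | by rewrite /=; lia|].
rewrite size_encode in al; have a6 : a %/ 6 < m by rewrite ltn_divLR; lia.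
have -> : a = Ordinal a6 * 6 + a %% 6 by rewrite /= -divn_eq.
rewrite nth_encode ?ltn_mod //; set e := Ordinal a6; rewrite /encode_edge.
have lt_he h : @encode_half_edge G h < m * 6 + n * 3 + 30.
  by rewrite /encode_half_edge; case: h => h [] /=; have := ltn_ord h; lia.
have := ltn_mod a 6; case: (a %% 6) => [|[|[|[|[|[|//]]]]]] _ /=; rewrite ?lt_he //.
- by have := ltn_ord (src e); lia.
- by have := ltn_ord (tgt e); lia.
- by case: (partner P e) => [[f b]|] /=; [have := ltn_ord f|]; lia.
- by case: (partner P e) => [[f []]|] /=; lia.
Qed.

(** * Red matchings and solutions *)

Definition red_matching (red : {set 'I_m}) :=
  edge_partition red /\ max_degree red <= 1.

(** A plane red graph excludes choosing both edges of a crossing pair, a plane blue graph excludes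
    choosing neither, and the degree bound is the matching condition. *)
Lemma solution_of_red red : red_matching red ->
  solution m (sr inp) (tg inp) (pa inp)
    [pred x | [exists e in red, x == e.+1]].
Proof.
case=> [[pr pb]] /bigmax_leqP deg.
have inS (e : 'I_m) : [exists e' in red, e.+1 == e'.+1] = (e \in red).
  apply/exists_inP/idP => [[e' re' /eqP[] /val_inj -> //]|re]; by exists e.
split=> [x /edge_ordP[e ->] pe|x y v /edge_ordP[e ->] /edge_ordP[f ->]] /=.
  have [f [b [ef ->]]] := pa_encodeP _ pe; rewrite !inS.
  have cef : cross_in_embedding e f by rewrite /cross_in_embedding ef.
  apply/idP/idP => [fr|]; first by apply/negP => er; have := pr _ _ er fr; rewrite cef.
  move=> ne; apply: contraT => nf; have := pb e f; rewrite !inE cef => /(_ ne nf).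
  by [].
rewrite !inS /incident !sr_encode !tg_encode => er fr ev fv.
have [w wv] : exists w : 'I_n, v = w by case/orP: ev => /eqP <-; eexists.
move: ev fv; rewrite wv !(inj_eq val_inj) => ev fv.
have /card_le1P/(_ e) := deg w isT.
by rewrite !inE er ev => /(_ isT f); rewrite !inE fr fv => /esym/eqP ->.
Qed.

(** Uncrossed members of [S] become blue; crossing edges alternate in [S], so neither colour
    contains a crossing. *)
Lemma red_of_solution S (red : {set 'I_m}) :
  solution m (sr inp) (tg inp) (pa inp) S ->
  (forall e, (e \in red) = S e.+1 && (pa inp e.+1 != 0)) -> red_matching red.
Proof.
move=> [alt mat] redE.
have eo (e : 'I_m) : edge m e.+1 by rewrite /edge /=.
have altE (e f : 'I_m) : cross_in_embedding e f -> 
    [/\ pa inp e.+1 != 0, pa inp f.+1 != 0 & S f.+1 = ~~ S e.+1].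
  rewrite /cross_in_embedding; case E: (partner P e) => [[g b]|//] /eqP gf.
  rewrite gf in E; have [b' E'] := partner_sym _ _ _ E.
  rewrite (pa_partner E) (pa_partner E'); split=> //.
  by rewrite -(pa_partner E) alt // (pa_partner E).
split; first split.
- move=> e f; rewrite !redE => /andP[Se _] /andP[Sf _]; apply/negP => /altE[_ _].
  by rewrite Se Sf.
- move=> e f; rewrite !inE !redE => ne nf; apply/negP => /altE[pe pf].
  by move: ne nf; rewrite pe pf !andbT => /negPf -> /negPf ->.
apply/bigmax_leqP => v _; apply/card_le1_eqP => e f; rewrite !inE !redE.
move=> /andP[/andP[Se _] ev] /andP[/andP[Sf _] fv].
have := mat _ _ v (eo e) (eo f) Se Sf; rewrite /incident !sr_encode !tg_encode.
by rewrite !(inj_eq val_inj) => /(_ ev fv) [] /val_inj.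
Qed.

End Encoding.

(* On words of O(log n) bits, i.e. holding numbers polynomial in n. *)
Theorem theorem3 (R : realType) :
  exists (prog : program) (k C : nat), forall G : one_plane_graph R,
  exists (T : nat) (s : state),
    [/\ exec (k * (nv G).+1 ^ k) prog (initial_state (encode G)) T s,
        0 < nv G -> T <= C * nv G ^ 2,
        (exists red : {set 'I_(ne G)}, edge_partition red /\ max_degree red <= 1) ->
          accepts s /\
          edge_partition (output_edges (ne G) s) /\
          max_degree (output_edges (ne G) s) <= 1
      & ~ (exists red : {set 'I_(ne G)}, edge_partition red /\ max_degree red <= 1) ->
          rejects s].
Proof.
(* The word size works because [6 n^2 + 3 n + 30 < 40 (n + 1)^2]. For positive [n],
   [250 (n + 1)^2 <= 1000 n^2], and [80 m + 60 <= 140 n^2] gives the rest of 1140. *)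
exists partition_code, 40, 1140 => G.
set W := 40 * _; set n := nv G; set m := ne G; set inp := nth 0 (encode G).
have mn : m <= n ^ 2 := ne_le R G.
have W_large : m * 6 + n * 3 + 30 < W.
  have : n.+1 ^ 2 <= n.+1 ^ 40 by rewrite leq_pexp2l.
  by rewrite -/n {}/W; move: (n.+1 ^ 40) mn => w; rewrite !expnS !expn0; lia.
clearbody W.
have s_lt x : edge m x -> sr inp x < n.
  by case/edge_ordP => e ->; rewrite sr_encode.
have t_lt x : edge m x -> tg inp x < n.
  by case/edge_ordP => e ->; rewrite tg_encode.
have st x : edge m x -> sr inp x != tg inp x.
  by case/edge_ordP => e ->; rewrite sr_encode tg_encode (inj_eq val_inj) src_neq_tgt.
have p_edge x : edge m x -> pa inp x != 0 -> edge m (pa inp x).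
  by case/edge_ordP => e -> /pa_encodeP[f [b [_ ->]]]; rewrite /edge /=.
have pK x : edge m x -> pa inp x != 0 -> pa inp (pa inp x) = x.
  case/edge_ordP => e -> /pa_encodeP[f [b [ef ->]]].
  by have [b' fe] := partner_sym _ _ _ _ _ ef; rewrite (pa_partner _ _ fe).
have p_neq x : edge m x -> pa inp x != x.
  case/edge_ordP => e ->; have [->//|/pa_encodeP[f [b [ef ->]]]] := eqVneq (pa inp e.+1) 0.
  by rewrite eqSS (inj_eq val_inj) eq_sym; exact: partner_neq ef.
have out a : m * 6 + 2 <= a -> inp a = 0.
  by move=> am; rewrite /inp nth_default // size_encode.
have regs0 i : nth 0 (nseq 23 0) i = 0 by rewrite nth_nseq if_same.
have startE : initial_state (encode G) = St (nseq 23 0) inp.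
  by congr State; apply/funext => i; rewrite regs0.
have ft : fits W (St (nseq 23 0) inp).
  split=> i; first by rewrite [reg _ i]regs0; lia.
  exact: ltn_trans (encode_lt _ G i) W_large.
have [T [l [M [ex _ [tT res]]]]] := wp_partition W n m inp W_large erefl erefl
  s_lt t_lt st p_edge pK p_neq out ft.
exists T, (St l M); rewrite startE; split=> //.
- move=> n0; apply: leq_trans tT _; rewrite -/n; move: mn; rewrite !expnS !expn0; nia.
- case=> red rm; case: res => [[acc [old set Mo]]|[_ no]]; last first.
    by case: (no _ (solution_of_red _ _ _ rm)).
  split=> //; apply: (red_of_solution _ _ _ _ (settled_solution _ _ _ _ _ s_lt p_edge _ set)).
  move=> e; have eo : edge m e.+1 by rewrite /edge /=.
  rewrite inE /= Mo // eo /=; have [_ sel _] := set.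
  by case: (boolP (selected _ _ _)) => // /(sel _ eo)[].
- move=> no; case: res => [[acc [old set Mo]]|[] //]; case: no.
  pose S x := edge m x && selected (sr inp) old x.
  exists [set e : 'I_m | S e.+1 && (pa inp e.+1 != 0)].
  apply: (red_of_solution _ _ S _ (settled_solution _ _ _ _ _ s_lt p_edge _ set)).
  by move=> e; rewrite inE.
Qed.
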